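(* Assume that $f$ is a nonconstant tropical meromorphic function with $$\limsup_{r\to\infty}\frac{\log T_f(r)}{r}=0,$$ and $a_j$ $(j=1,2,\dots,q)$, defining tropical polynomials $P_j$, are distinct values of $\mathbb{R}$ such that $f\oplus a_j\not\equiv a_j$, respectively. Then $$qT_f(r)=\sum_{j=1}^{q}N\bigl(r,1_o\oslash(P_j\circ f)\bigr)+o(T_f(r)),$$ where $r$ approaches infinity outside an exceptional set of zero upper density measure.
   Context: Tropical operations: $x\oplus y=\max(x,y)$, $x\odot y=x+y$, $x\oslash y=x-y$, $1_o=0$. A tropical meromorphic function is a continuous piecewise linear $f:\mathbb{R}\to\mathbb{R}$ (possibly infinitely many pieces, derivative discontinuities locally finite). With $\omega_f(x)=\lim_{\varepsilon\to0+}\{f'(x+\varepsilon)-f'(x-\varepsilon)\}$, $x$ is a zero of multiplicity $\omega_f(x)$ if $\omega_f(x)>0$ and a pole of multiplicity $-\omega_f(x)$ if $\omega_f(x)<0$. A tropical entire function is a tropical meromorphic function without poles (equivalently, convex). $n(r,f)$ is the number of poles of $f$ in $(-r,r)$ counted with multiplicity, and $N(r,f)=\frac12\int_0^r n(t,f)\,dt$. So $N(r,1_o\oslash h)$, where $1_o\oslash h=-h$, counts the zeros of $h$. Write $f=f_1\oslash f_0=f_1-f_0$, i.e. $f=[f_0:f_1]:\mathbb{R}\to\mathbb{TP}^1$, with $f_0,f_1$ tropical entire functions without common zeros (always possible). With $\|f(x)\|=\max\{f_0(x),f_1(x)\}$, $T_f(r)=\frac12[\|f(r)\|+\|f(-r)\|]-\|f(0)\|$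 (independent of the choice). A value $a_j\in\mathbb{R}$ is written $a_j=[a_{j1}:a_{j0}]$ with $a_{j0},a_{j1}\in\mathbb{R}$, $a_j=a_{j0}-a_{j1}$, and defines $P_j(x)=(a_{j0}\odot x_0)\oplus(a_{j1}\odot x_1)$ on $\mathbb{R}^2$; $P_j\circ f=\max\{a_{j0}+f_0,\,a_{j1}+f_1\}$. (A different choice of $a_{j0},a_{j1}$ changes $P_j\circ f$ only by an additive constant.) A set $E$ has zero upper density measure if $\limsup_{r\to\infty}\frac1r\int_{E\cap[1,r]}dt=0$. *)

(* Defs.v *)
From mathcomp Require Export all_boot all_order all_algebra.
From mathcomp Require Export all_classical all_reals all_analysis.
Export Order.TTheory GRing.Theory Num.Theory.
Export numFieldNormedType.Exports.

Set Implicit Arguments.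
Unset Strict Implicit.
Unset Printing Implicit Defensive.

Local Open Scope classical_set_scope.
Local Open Scope ring_scope.

Definition locally_finite_set (R : realType) (D : set R) : Prop :=
  forall r : R, finite_set (D `&` `[- r, r]).

(* Slopes are arbitrary real numbers, and the set D of possible breakpoints
   may be infinite. *)
Definition tropical_meromorphic (R : realType) (f : R -> R) : Prop :=
  continuous f /\
  exists2 D : set R, locally_finite_set D &
    forall x, ~ D x -> exists a b : R, \forall y \near x, f y = a * y + b.

Definition omega (R : realType) (f : R -> R) (x : R) : R :=
  lim ((derive1 f (x + e) - derive1 f (x - e)) @[e --> 0^'+]).

Definition tropical_zero (R : realType) (f : R -> R) (x : R) : Prop :=
  0 < omega f x.

Definition tropical_pole (R : realType) (f : R -> R) (x : R) : Prop :=
  omega f x < 0.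

Definition tropical_entire (R : realType) (f : R -> R) : Prop :=
  tropical_meromorphic f /\ forall x, ~ tropical_pole f x.

(* The sum over a set is the library's finitely supported sum; for tropical
   meromorphic f the set of poles in a bounded interval is finite, so no
   junk value arises. *)
Definition pole_count (R : realType) (r : R) (f : R -> R) : R :=
  \sum_(x \in `]- r, r[ `&` tropical_pole f) (- omega f x).

Definition pole_counting (R : realType) (r : R) (f : R -> R) : R :=
  2^-1 * (\int[lebesgue_measure]_(t in `[0, r]) pole_count t f)%R.

(* f = f1 (/) f0 = f1 - f0, that is f = [f0 : f1], in reduced form. *)
Definition reduced_representation (R : realType) (f f0 f1 : R -> R) : Prop :=
  [/\ tropical_entire f0, tropical_entire f1,
      forall x, ~ (tropical_zero f0 x /\ tropical_zero f1 x) &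
      forall x, f x = f1 x - f0 x].

Definition tropical_norm (R : realType) (f0 f1 : R -> R) (x : R) : R :=
  Num.max (f0 x) (f1 x).

Definition characteristic (R : realType) (f0 f1 : R -> R) (r : R) : R :=
  2^-1 * (tropical_norm f0 f1 r + tropical_norm f0 f1 (- r))
  - tropical_norm f0 f1 0.

(* P o f, for the linear tropical form P = (a0 (.) x0) (+) (a1 (.) x1)
   evaluated at f = [f0 : f1]; it corresponds to the value a0 - a1. *)
Definition tropical_form (R : realType) (a0 a1 : R) (f0 f1 : R -> R) (x : R) :
  R := Num.max (a0 + f0 x) (a1 + f1 x).

Definition zero_upper_density (R : realType) (E : set R) : Prop :=
  limf_esup
    (fun r : R => (r^-1 * \int[lebesgue_measure]_(t in E `&` `[1, r]) 1)%:E)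
    (pinfty_nbhs R) = 0%E.

(* Main.v *)
(** [T_f] and the Jensen expression of [P_j o f] are the same functional,
    [g |-> (g r + g (- r)) / 2 - g 0], applied to [max f0 f1] and to
    [max (a_j0 + f0) (a_j1 + f1)].  These functions differ by a bounded amount,
    so the tropical Jensen formula gives [T_f = N_j + O(1)] for every [j].  It
    remains that [T_f] tends to infinity, which convexity of [f0], [f1] and
    [max f0 f1] yields as soon as [f] is not constant.  The exceptional set is
    empty. *)
Require Import Defs.
From mathcomp Require Import lra ring.

Set Implicit Arguments.
Unset Strict Implicit.
Unset Printing Implicit Defensive.

Local Open Scope classical_set_scope.
Local Open Scope ring_scope.

(** * From local to global on intervals *)

Lemma locally_constant_itv (R : realType) (I : set R) (h : R -> R) :
  is_interval I -> (forall x, I x -> \forall y \near x, h y = h x) ->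
  forall x y, I x -> I y -> h y = h x.
Proof.
move=> II hI; have main x y : x <= y -> I x -> I y -> h y = h x.
  move=> xy Ix Iy.
  have hd z : x <= z <= y -> is_derive z 1 h 0.
    move=> /(II _ _ Ix Iy) /hI hz.
    apply: (near_eq_is_derive (f := cst (h z))); near=> t.
    by rewrite /cst; apply/esym; near: t.
  have [z zxy||z _] := @MVT_segment _ h (cst 0) x y xy.
  - by apply: hd; rewrite !ltW ?(itvP zxy).
  - apply: continuous_in_subspaceT => z; rewrite inE /= in_itv /= => /hd [dz _].
    exact/differentiable_continuous/derivable1_diffP.
  - by rewrite mul0r => /subr0_eq.
move=> x y Ix Iy; have [xy|yx] := leP x y; first exact: main.
by apply/esym/main => //; exact: ltW.
Unshelve. all: by end_near. Qed.

Lemma is_derive_affine (R : realType) (h : R -> R) (x c d : R) :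
  (\forall y \near x, h y = d + c * (y - x)) -> is_derive x 1 h c.
Proof.
move=> hx; apply: (near_eq_is_derive (f := fun y => d + c * (y - x))).
  by near=> y; apply/esym; near: y.
by apply: is_derive_eq; rewrite add0r mul1r subr0; exact: mulr1.
Unshelve. all: by end_near. Qed.

(** The derivative is locally constant on [I], hence equal to a single [c] there. Then [h z - c * z]
    is itself locally constant, so the slope is the same across all of [I]. *)
Lemma locally_affine_itv (R : realType) (I : set R) (h : R -> R) :
  is_interval I ->
  (forall x, I x -> exists c, \forall y \near x, h y = h x + c * (y - x)) ->
  exists c, forall x y, I x -> I y -> h y = h x + c * (y - x).
Proof.
move=> II hI; have [I0|/set0P[m Im]] := eqVneq I set0.
  by exists 0 => x y; rewrite I0.
have germ x c : (\forall y \near x, h y = h x + c * (y - x)) ->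
    \forall y \near x, h^`()%classic y = c.
  (* The expansion at [x] also holds around every [y] close to [x], so it gives the derivative at
     [y] and not only at [x]. *)
  move=> /nbhs_interior; apply: filterS => y hy.
  have dy : is_derive y 1 h c.
    apply: (@is_derive_affine _ _ _ _ (h x + c * (y - x))).
    by move: hy; apply: filterS => z ->; ring.
  by rewrite derive1E (@derive_val _ _ _ _ _ _ _ dy).
have der_cst x : I x -> h^`()%classic x = h^`()%classic m.
  move=> Ix; apply: (@locally_constant_itv _ I h^`()%classic) => // y /hI[c /germ hc].
  by move: (nbhs_singleton hc) => ->.
set c := h^`()%classic m in der_cst; exists c => x y Ix Iy.
suff : h y - c * y = h x - c * x by move=> ?; lra.
apply: (@locally_constant_itv _ I (fun z => h z - c * z)) => // z Iz.
have [c' hc'] := hI z Iz; move: (nbhs_singleton (germ _ _ hc')).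
by rewrite der_cst // => cc; move: hc'; apply: filterS => t ->; rewrite cc; ring.
Qed.

(** * Slope jumps of germs and their calculus *)

(* The germ of [h] at [x] has left slope [c] and right slope [c + j]. *)
Definition has_jump (R : realType) (h : R -> R) (x j : R) : Prop :=
  exists c, \forall y \near x,
    h y = h x + c * (y - x) + j * Num.max (y - x) 0.

Lemma has_jump_continuous (R : realType) (h : R -> R) (x j : R) :
  has_jump h x j -> {for x, continuous h}.
Proof.
move=> [c hx]; have: (fun y => h x + c * (y - x) + j * Num.max (y - x) 0) y
    @[y --> x] --> (h x + c * (x - x) + j * Num.max (x - x) 0).
  have cB : y - x @[y --> x] --> x - x by apply: cvgB; [exact: cvg_id|exact: cvg_cst].
  apply: cvgD; first by apply: cvgD; [exact: cvg_cst|exact: cvgMr].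
  apply: cvgMr.
  by apply: (@continuous_max R R (fun y => y - x) (cst 0)) => //; exact: cvg_cst.
rewrite subrr maxxx !mulr0 !addr0 => H.
apply: cvg_trans H; apply: near_eq_cvg; near=> y; apply/esym; near: y.
exact: hx.
Unshelve. all: by end_near. Qed.

(** For small [e > 0] the derivative is [c + j] at [x + e] and [c] at [x - e], so the function under
    the limit in [omega] is constantly [j] there. *)
Lemma has_jump_omega (R : realType) (h : R -> R) (x j : R) :
  has_jump h x j -> omega h x = j.
Proof.
move=> [c /nbhs_ballP[d /= d0 hx]].
have hR e : 0 < e < d -> h^`()%classic (x + e) = c + j.
  move=> /andP[e0 ed].
  have dy : is_derive (x + e) 1 h (c + j).
    apply: (@is_derive_affine _ _ _ _ (h x + (c + j) * e)).
    (* This radius keeps [y] to the right of [x] and within distance [d] of it, where only one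
       affine branch is seen. *)
    have e0' : 0 < Num.min e (d - e) by rewrite lt_min e0 subr_gt0.
    apply/nbhs_ballP; exists (Num.min e (d - e)) => //= y.
    rewrite /ball /= lt_min !ltr_norml => /andP[/andP[h1 h2] /andP[h3 h4]].
    rewrite hx; last by rewrite /ball /= ltr_norml; lra.
    by rewrite max_l; [ring|lra].
  by rewrite derive1E (@derive_val _ _ _ _ _ _ _ dy).
have hL e : 0 < e < d -> h^`()%classic (x - e) = c.
  move=> /andP[e0 ed].
  have dy : is_derive (x - e) 1 h c.
    apply: (@is_derive_affine _ _ _ _ (h x - c * e)).
    have e0' : 0 < Num.min e (d - e) by rewrite lt_min e0 subr_gt0.
    apply/nbhs_ballP; exists (Num.min e (d - e)) => //= y.
    rewrite /ball /= lt_min !ltr_norml => /andP[/andP[h1 h2] /andP[h3 h4]].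
    rewrite hx; last by rewrite /ball /= ltr_norml; lra.
    by rewrite max_r; [ring|lra].
  by rewrite derive1E (@derive_val _ _ _ _ _ _ _ dy).
apply: cvg_lim => //; apply: (@cvg_trans _ (j @[e --> 0^'+])); last exact: cvg_cst.
apply: near_eq_cvg; near=> e.
have ed : 0 < e < d by apply/andP; split; near: e; [exact: nbhs_right_gt|exact: nbhs_right_lt].
by rewrite hR // hL //; ring.
Unshelve. all: by end_near. Qed.

Lemma has_jumpD (R : realType) (h k : R -> R) (x j l : R) :
  has_jump h x j -> has_jump k x l -> has_jump (fun y => h y + k y) x (j + l).
Proof.
move=> [c hc] [d kd]; exists (c + d); near=> y.
by rewrite (near hc y) // (near kd y) //; ring.
Unshelve. all: by end_near. Qed.

Lemma has_jumpZ (R : realType) (a : R) (h : R -> R) (x j : R) :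
  has_jump h x j -> has_jump (fun y => a * h y) x (a * j).
Proof.
by move=> [c hc]; exists (a * c); move: hc; apply: filterS => y ->; ring.
Qed.

Lemma has_jumpN (R : realType) (h : R -> R) (x j : R) :
  has_jump h x j -> has_jump (fun y => - h y) x (- j).
Proof.
by move=> [c hc]; exists (- c); move: hc; apply: filterS => y ->; ring.
Qed.

Lemma has_jump_cstD (R : realType) (a : R) (h : R -> R) (x j : R) :
  has_jump h x j -> has_jump (fun y => a + h y) x j.
Proof.
by move=> [c hc]; exists c; move: hc; apply: filterS => y ->; ring.
Qed.

Lemma has_jump_ramp (R : realType) (z x : R) :
  has_jump (fun y => Num.max (y - z) 0) x (x == z)%:R.
Proof.
have [zx|xz|->] := ltgtP z x.
- exists 1; near=> y.
  have zy : z < y by near: y; exact: lt_nbhsr.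
  by rewrite !(max_l (x := _ - z)) ?subr_ge0 ?ltW // mul0r; ring.
- exists 0; near=> y.
  have zy : y < z by near: y; exact: lt_nbhsl.
  by rewrite !(max_r (x := _ - z)) ?subr_le0 ?ltW // !mul0r !addr0.
- by exists 0; near=> y; rewrite subrr maxxx /=; ring.
Unshelve. all: by end_near. Qed.

Lemma has_jump_sum_ramp (R : realType) (w : R -> R) (s : seq R) (x : R) :
  uniq s ->
  has_jump (fun y => \sum_(z <- s) w z * Num.max (y - z) 0) x
    ((x \in s)%:R * w x).
Proof.
elim: s => [_|z s IHs /= /andP[zs us]].
  by exists 0; near=> y; rewrite !big_nil in_nil !mul0r !addr0.
have -> : (fun y => \sum_(t <- z :: s) w t * Num.max (y - t) 0) =
    (fun y => w z * Num.max (y - z) 0 + \sum_(t <- s) w t * Num.max (y - t) 0).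
  by apply/funext => y; rewrite big_cons.
have -> : (x \in z :: s)%:R * w x = w z * (x == z)%:R + (x \in s)%:R * w x.
  rewrite in_cons; have [->|] := eqVneq x z; last by rewrite mulr0 add0r.
  by rewrite (negbTE zs) mul1r mulr1 mul0r addr0.
by apply: has_jumpD (IHs us); apply/has_jumpZ/has_jump_ramp.
Unshelve. all: by end_near. Qed.

(** Where the values at [x] differ, the larger function wins nearby and keeps its jump. At a tie,
    the right slope is the larger right slope and the left slope is the smaller left slope, since
    [y - x] is negative on the left. *)
Lemma has_jump_max (R : realType) (h k : R -> R) (x j l : R) :
  0 <= j -> 0 <= l -> has_jump h x j -> has_jump k x l ->
  exists2 m, 0 <= m & has_jump (fun y => Num.max (h y) (k y)) x m.
Proof.
move=> j0 l0 hj kl.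
have ch := has_jump_continuous hj; have ck := has_jump_continuous kl.
have [hk|kh|hk] := ltgtP (h x) (k x).
- exists l => //; case: kl => c kc; exists c; near=> y.
  have -> : Num.max (h y) (k y) = k y.
    apply/max_r/ltW; rewrite -subr_gt0; near: y.
    by apply: (cvgr_gt (k x - h x)); [exact: cvgB|rewrite subr_gt0].
  by rewrite max_r ?ltW //; near: y.
- exists j => //; case: hj => c kc; exists c; near=> y.
  have -> : Num.max (h y) (k y) = h y.
    apply/max_l/ltW; rewrite -subr_gt0; near: y.
    by apply: (cvgr_gt (h x - k x)); [exact: cvgB|rewrite subr_gt0].
  by rewrite max_l ?ltW //; near: y.
- case: hj kl => c hc [d kd].
  exists (Num.max (c + j) (d + l) - Num.min c d).
    by rewrite subr_ge0 ge_min !le_max; lra.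
  exists (Num.min c d); near=> y.
  rewrite (near hc y) // (near kd y) // hk maxxx -!addrA -!addr_maxr.
  congr (_ + _); have [xy|yx] := leP 0 (y - x).
    have -> : c * (y - x) + j * (y - x) = (c + j) * (y - x) by ring.
    have -> : d * (y - x) + l * (y - x) = (d + l) * (y - x) by ring.
    by rewrite -maxr_pMl //; ring.
  rewrite !mulr0 !addr0; have [cd|/ltW dc] := leP c d.
    by rewrite max_l // ler_wnM2r // ltW.
  by rewrite max_r // ler_wnM2r // ltW.
Unshelve. all: by end_near. Qed.

(** * Tropical meromorphic functions through their germs *)

(** With [omega h x] itself as the jump, the [lim] in [omega] is a genuine slope difference
    everywhere. No set of breakpoints is carried along: local finiteness is recovered from the germs
    by compactness. *)
Definition piecewise_linear (R : realType) (h : R -> R) : Prop :=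
  forall x, has_jump h x (omega h x).

(** On [I] the function [h z - c * z] is constant. If its value at [x] were different, continuity
    would keep it different near [x], where [I] has points. *)
Lemma affine_itv_closure (R : realType) (I : set R) (h : R -> R) (x c : R) :
  {for x, continuous h} -> closure I x ->
  (forall y z, I y -> I z -> h z = h y + c * (z - y)) ->
  forall y, I y -> h y = h x + c * (y - x).
Proof.
move=> hx clI hI y Iy; apply/eqP/negPn/negP => /eqP hy.
have /clI [z [Iz]] : \forall z \near x, h z - c * z - (h y - c * y) != 0.
  have k0 : h x - c * x - (h y - c * y) != 0 by apply/eqP => ?; apply: hy; lra.
  apply: (@cvgr_neq0 R R R (nbhs x) _ _ _ _ k0).
  apply: cvgB; last exact: cvg_cst.
  by apply: cvgB => //; apply: cvgMr; exact: cvg_id.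
by rewrite /= (hI y z) // => /negP; apply; apply/eqP; ring.
Qed.

(** Since [x] is not a limit point of [D], a punctured ball around it avoids [D]. Then [h] is affine
    on each half of that ball, and continuity joins the two pieces at [x]. *)
Lemma meromorphic_piecewise_linear (R : realType) (h : R -> R) :
  tropical_meromorphic h -> piecewise_linear h.
Proof.
move=> [ch [D finD hD]] x; suff [j hj] : exists j, has_jump h x j.
  by rewrite (has_jump_omega hj).
have : ~ limit_point D x.
  move=> /limit_point_infinite_setP /(_ `](x - 1), (x + 1)[%classic).
  have nx : nbhs x `](x - 1), (x + 1)[%classic by apply: near_in_itvoo; rewrite in_itv /=; lra.
  move=> /(_ nx); apply; apply: sub_finite_set (finD (`|x| + 1)) => y [] /=.
  rewrite !in_itv /= => y1 Dy; split=> //.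
  by have := ler_norm x; have := lerNnormlW (lexx `|x|); lra.
rewrite not_limit_pointE => -[X /nbhs_ballP[d /= d0 dX] DX].
have affine (I : set R) : is_interval I -> I `<=` ball x d -> ~ I x ->
    closure I x -> exists c, forall y, I y -> h y = h x + c * (y - x).
  move=> II Id nIx clI; have [y Iy|c hc] := @locally_affine_itv _ _ h II.
    have [|a [b ab]] := hD y.
      by move=> Dy; apply: nIx; rewrite -(DX y) //; split => //; exact/dX/Id.
    exists a; have hy := nbhs_singleton ab.
    by move: ab; apply: filterS => z ->; rewrite hy; ring.
  by exists c; apply: affine_itv_closure => //; exact: ch.
have [||||cr hr] := affine `]x, (x + d)[%classic.
- exact: interval_is_interval.
- by move=> y /=; rewrite in_itv /ball /= ltr_norml; lra.
- by rewrite /= in_itv /= ltxx.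
- move=> B /nbhs_ballP[e /= e0 eB].
  have m0 : 0 < Num.min d e by rewrite lt_min d0.
  have [md me] : Num.min d e <= d /\ Num.min d e <= e by rewrite !ge_min !lexx orbT.
  exists (x + Num.min d e / 2); split; first by rewrite /= in_itv /=; lra.
  by apply: eB; rewrite /ball /= ltr_norml; lra.
have [||||cl hl] := affine `](x - d), x[%classic.
- exact: interval_is_interval.
- by move=> y /=; rewrite in_itv /ball /= ltr_norml; lra.
- by rewrite /= in_itv /= ltxx andbF.
- move=> B /nbhs_ballP[e /= e0 eB].
  have m0 : 0 < Num.min d e by rewrite lt_min d0.
  have [md me] : Num.min d e <= d /\ Num.min d e <= e by rewrite !ge_min !lexx orbT.
  exists (x - Num.min d e / 2); split; first by rewrite /= in_itv /=; lra.
  by apply: eB; rewrite /ball /= ltr_norml; lra.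
exists (cr - cl), cl; apply/nbhs_ballP; exists d => //= y.
rewrite /ball /= ltr_norml => xyd; have [xy|yx|->] := ltgtP x y.
- by rewrite max_l ?subr_ge0 ?ltW // hr ?in_itv /=; [ring|rewrite in_itv /=; lra].
- by rewrite max_r ?subr_le0 ?ltW // hl ?in_itv /=; [ring|rewrite in_itv /=; lra].
- by rewrite subrr maxxx; ring.
Qed.

(** * Finiteness of breakpoints and the tropical Jensen formula *)

Lemma omega_eq0_near (R : realType) (h : R -> R) (x j : R) :
  has_jump h x j -> \forall y \near x, y != x -> omega h y = 0.
Proof.
move=> [c /nbhs_interior]; apply: filterS => y hy.
rewrite neq_lt => /orP[yx|xy]; apply: has_jump_omega.
- exists c; have hyx := nbhs_singleton hy; near=> z.
  have zx : z < x by near: z; exact: lt_nbhsl.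
  rewrite (near hy z) // hyx !(max_r (x := _ - x)) ?subr_le0 ?ltW //.
  by ring.
- exists (c + j); have hyx := nbhs_singleton hy; near=> z.
  have xz : x < z by near: z; exact: lt_nbhsr.
  rewrite (near hy z) // hyx !(max_l (x := _ - x)) ?subr_ge0 ?ltW //.
  by ring.
Unshelve. all: by end_near. Qed.

(** By Bolzano-Weierstrass, infinitely many breakpoints in [[- r, r]] would accumulate somewhere,
    but [omega_eq0_near] isolates each of them. *)
Lemma jumps_finite (R : realType) (h : R -> R) (r : R) : piecewise_linear h ->
  exists2 s : seq R, uniq s &
    forall z, z \in s <-> - r <= z <= r /\ omega h z != 0.
Proof.
move=> hpl; set E := `[- r, r] `&` [set z | omega h z != 0].
have /finite_seqP[s Es] : finite_set E.
  apply: contrapT => /infinite_bounded_limit_point_nonempty [].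
    exists r; split; first exact: num_real.
    move=> M rM x [/=]; rewrite in_itv /= => xr _.
    by rewrite ler_norml; lra.
  move=> a; suff: ~ limit_point E a by []; rewrite not_limit_pointE.
  exists [set y | y != a -> omega h y = 0]; first exact: omega_eq0_near (hpl a).
  move=> y [[_ /= /eqP y0] ya]; apply: contrapT => /eqP yna.
  by apply: y0; exact: ya.
exists (undup s); first exact: undup_uniq.
move=> z; rewrite mem_undup.
have -> : (z \in s : Prop) = E z by rewrite Es.
by rewrite /E /= in_itv.
Qed.

(* Subtracting [omega h z * max(y - z, 0)] for every breakpoint [z] of
   [-r, r] leaves a function that is affine on [-r, r]. *)
Lemma tropical_jensen (R : realType) (h : R -> R) (r : R) (s : seq R) :
  piecewise_linear h -> uniq s ->
  (forall z, z \in s <-> - r <= z <= r /\ omega h z != 0) -> 0 <= r ->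
  h r + h (- r) - 2 * h 0 = \sum_(z <- s) omega h z * (r - `|z|).
Proof.
move=> hpl us hs r0.
pose g y := \sum_(z <- s) omega h z * Num.max (y - z) 0.
have [x|c hc] := @locally_affine_itv _ `[- r, r]%classic (fun y => h y + - g y)
    (@interval_is_interval _ _).
  rewrite /= in_itv /= => xr.
  have := has_jumpD (hpl x) (has_jumpN (has_jump_sum_ramp (omega h) x us)).
  suff -> : omega h x - (x \in s)%:R * omega h x = 0.
    by move=> [c hc]; exists c; move: hc; apply: filterS => y /= ->; rewrite /g; ring.
  case: (boolP (x \in s)) => xs; first by rewrite mul1r subrr.
  rewrite mul0r subr0; apply/eqP/negPn/negP => x0.
  by move/negP: xs; apply; apply/hs.
have I0 : `[- r, r]%classic 0 by rewrite /= in_itv /=; lra.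
have Ir : `[- r, r]%classic r by rewrite /= in_itv /=; lra.
have INr : `[- r, r]%classic (- r) by rewrite /= in_itv /=; lra.
have /= hr := hc 0 r I0 Ir; have /= hNr := hc 0 (- r) I0 INr.
(* The symmetric second difference kills affine functions, so [h] and [g] have the same one. *)
have -> : h r + h (- r) - 2 * h 0 = g r + g (- r) - 2 * g 0 by lra.
rewrite /g mulr_sumr -!big_split /= -sumrB; apply: eq_big_seq => z /hs[zr _].
(* The ramp at [z] contributes [r - z] at [r] and nothing at [- r]; the term at [0] corrects [r - z]
   to [r + z] when [z < 0]. *)
rewrite (max_l (x := r - z)) ?(max_r (x := - r - z)); [|lra..].
have [z0|z0] := leP 0 z; first by rewrite max_r ?ger0_norm; [ring|lra..].
by rewrite max_l ?ltr0_norm; [ring|lra..].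
Qed.

(** * The integrated counting function *)

(** A point [x] lies in the open interval []- t, t[] exactly when [t > |x|], hence steps open on the
    left. Each step integrates to [r - |x|]. *)
Lemma Rintegral_sum_steps (R : realType) (w : R -> R) (r : R) (s : seq R) :
  {in s, forall x, `|x| <= r} ->
  \int[lebesgue_measure]_(t in `[0, r])
    (\sum_(x <- s) w x * \1_(`]`|x|, r]) t) = \sum_(x <- s) w x * (r - `|x|).
Proof.
have mI : measurable (`[0, r]%classic : set (g_sigma_algebraType (R.-ocitv.-measurable))) by exact: measurable_itv.
have int1 (x : R) : lebesgue_measure.-integrable `[0, r]
    (EFin \o (fun t => \1_(`]`|x|, r]) t : R)).
  exact: integrableS (integrable_indic_itv `|x| r false false).
have intw (x : R) : lebesgue_measure.-integrable `[0, r]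
    (EFin \o (fun t => w x * \1_(`]`|x|, r]) t)).
  exact: (integrableZl mI (w x) (int1 x)).
have ints (s' : seq R) : lebesgue_measure.-integrable `[0, r]
    (EFin \o (fun t => \sum_(x <- s') w x * \1_(`]`|x|, r]) t)).
  apply: (eq_integrable mI (fun t => (\sum_(x <- s') (w x * \1_(`]`|x|, r]) t)%:E)%E)).
    by move=> t _; rewrite /= sumEFin.
  by apply: integrable_sum => // x _; exact: intw.
elim: s => [_|x s IHs sr].
  under eq_Rintegral do rewrite big_nil.
  by rewrite Rintegral_cst // mul0r big_nil.
under eq_Rintegral do rewrite big_cons.
rewrite RintegralD // big_cons IHs; last first.
  by move=> y ys; apply: sr; rewrite in_cons ys orbT.
rewrite RintegralZl //; congr (w x * _ + _).
rewrite /Rintegral integral_indic // (_ : _ `&` _ = `]`|x|, r]%classic); last first.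
  apply/seteqP; split => y /=; rewrite !in_itv /=; first by case.
  by move=> xy; split=> //; have := normr_ge0 x; lra.
have xr : `|x| <= r by apply: sr; rewrite mem_head.
(* The measure formula returns [0] for an empty interval; with [|x| <= r] this forces [|x| = r], so
   the value is still [r - |x|]. *)
rewrite [X in fine X]lebesgue_measure_itv /= lte_fin; case: ltP => [_ //|rx].
by apply/eqP; rewrite eq_sym subr_eq0 eq_le xr rx.
Qed.

Lemma pole_counting_opp (R : realType) (h : R -> R) (r : R) :
  piecewise_linear h -> (forall x, 0 <= omega h x) -> 0 <= r ->
  pole_counting r (fun x => - h x) = 2^-1 * (h r + h (- r)) - h 0.
Proof.
move=> hpl h0 r0; have [s us hs] := jumps_finite r hpl.
have omegaN x : omega (fun y => - h y) x = - omega h x.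
  exact/has_jump_omega/has_jumpN.
rewrite /pole_counting.
under eq_Rintegral => t.
  rewrite inE /= in_itv /= => /andP[t0 tr].
  have -> : pole_count t (fun x => - h x) =
      \sum_(x <- s) omega h x * \1_(`]`|x|, r]) t.
    rewrite /pole_count.
    under eq_fsbigr do rewrite omegaN opprK.
    (* For [t <= r] every pole in []- t, t[] is listed in [s], so the finitely supported sum can be
       taken over the fixed list [s]. *)
    rewrite (_ : _ `&` _ = (`]- t, t[ `&` tropical_pole (fun x => - h x)) `&` [set` s]); last first.
      apply/seteqP; split => x /=; last by case.
      move=> [xt xp]; split => //; apply/hs; move: xt xp.
      rewrite in_itv /= /tropical_pole omegaN oppr_lt0 => xt xp.
      by rewrite gt_eqF //; split=> //; lra.
    rewrite fsbig_mkcondl -fsbig_seq //; apply: eq_big_seq => x xs.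
    have [_ x0] := (hs x).1 xs.
    have xp : 0 < omega h x by rewrite lt_neqAle eq_sym x0 h0.
    rewrite indicE; case: ifPn => xt.
      rewrite mem_set ?mulr1 //; move: xt; rewrite inE /= !in_itv /= => -[xt _].
      by rewrite tr andbT ltr_norml.
    rewrite memNset ?mulr0 // => /=; rewrite in_itv /= ltr_norml => /andP[xt' _].
    move/negP: xt; apply; rewrite inE; split; first by rewrite /= in_itv.
    by rewrite /tropical_pole omegaN oppr_lt0.
  over.
rewrite /= Rintegral_sum_steps; last by move=> x /hs[xr _]; rewrite ler_norml.
by rewrite -(tropical_jensen hpl us hs r0); field.
Qed.

(** * Growth of convex piecewise linear functions *)

(** All terms of the Jensen sum are nonnegative; only the one at [x] is kept. A single breakpoint
    thus forces linear growth. *)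
Lemma jump_growth (R : realType) (h : R -> R) (x r : R) :
  piecewise_linear h -> (forall x, 0 <= omega h x) -> `|x| <= r ->
  omega h x * (r - `|x|) <= h r + h (- r) - 2 * h 0.
Proof.
move=> hpl h0 xr; have [s us hs] := jumps_finite r hpl.
have r0 : 0 <= r by exact: le_trans (normr_ge0 x) xr.
rewrite (tropical_jensen hpl us hs r0).
have sge0 (s' : seq R) : {subset s' <= s} -> 0 <= \sum_(z <- s') omega h z * (r - `|z|).
  move=> s's; rewrite big_seq; apply: sumr_ge0 => z /s's /hs[zr _].
  by rewrite mulr_ge0 // subr_ge0 ler_norml.
have [->|x0] := eqVneq (omega h x) 0; first by rewrite mul0r sge0.
have xs : x \in s by apply/hs; rewrite -ler_norml.
rewrite (big_rem x) //= lerDl; apply: sge0; exact: mem_rem.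
Qed.

Lemma affine_or_unbounded (R : realType) (h : R -> R) :
  piecewise_linear h -> (forall x, 0 <= omega h x) ->
  (exists c, forall y, h y = h 0 + c * y) \/
  (forall C : R, \forall r \near +oo, C < h r + h (- r)).
Proof.
move=> hpl h0; have [omega0|/existsNP[x /eqP x0]] := pselect (forall x, omega h x = 0).
  left.
  have [|x _|c hc] := @locally_affine_itv _ setT h; first by [].
  - have [c hc] := hpl x; exists c; move: hc; apply: filterS => y ->.
    by rewrite omega0 mul0r addr0.
  - by exists c => y; rewrite (hc 0) // subr0.
right=> C; have xp : 0 < omega h x by rewrite lt_neqAle eq_sym x0 h0.
near=> r.
have xr : `|x| <= r by near: r; apply: nbhs_pinfty_ge; exact: num_real.
have Cr : `|x| + (C - 2 * h 0) / omega h x < r.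
  by near: r; apply: nbhs_pinfty_gt; exact: num_real.
have := jump_growth hpl h0 xr.
have : C - 2 * h 0 < omega h x * (r - `|x|).
  by rewrite [ltRHS]mulrC -ltr_pdivrMr // ltrBrDl.
lra.
Unshelve. all: by end_near. Qed.

Lemma affine_le_slope (R : realType) (c d a b : R) :
  (forall y, a + c * y <= b + d * y) -> c = d.
Proof.
move=> H; apply/eqP; rewrite -subr_eq0; apply/negPn/negP => cd.
(* At this point [(c - d) * y] exceeds [b - a] by one. *)
have := H ((b - a + 1) / (c - d)).
have : (c - d) * ((b - a + 1) / (c - d)) = b - a + 1 by rewrite mulrC divfK.
by move=> E; lra.
Qed.

Lemma piecewise_linear_cstD (R : realType) (a : R) (h : R -> R) :
  piecewise_linear h -> (forall x, 0 <= omega h x) ->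
  piecewise_linear (fun x => a + h x) /\ forall x, 0 <= omega (fun x => a + h x) x.
Proof.
move=> hpl h0.
have omegaD x : omega (fun y => a + h y) x = omega h x.
  exact/has_jump_omega/has_jump_cstD.
by split=> x; rewrite omegaD //; exact: has_jump_cstD.
Qed.

Lemma piecewise_linear_max (R : realType) (h k : R -> R) :
  piecewise_linear h -> (forall x, 0 <= omega h x) ->
  piecewise_linear k -> (forall x, 0 <= omega k x) ->
  piecewise_linear (fun x => Num.max (h x) (k x)) /\
  forall x, 0 <= omega (fun x => Num.max (h x) (k x)) x.
Proof.
move=> hpl h0 kpl k0; split=> x;
  have [m m0 hm] := has_jump_max (h0 x) (k0 x) (hpl x) (kpl x);
  by rewrite (has_jump_omega hm).
Qed.

(* An affine [max f0 f1] dominates the convex functions [f0] and [f1], which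
   are then affine with the same slope, so that [f1 - f0] is constant. *)
Lemma tropical_norm_unbounded (R : realType) (f0 f1 : R -> R) :
  piecewise_linear f0 -> (forall x, 0 <= omega f0 x) ->
  piecewise_linear f1 -> (forall x, 0 <= omega f1 x) ->
  ~ (exists c, forall x, f1 x - f0 x = c) ->
  forall C : R, \forall r \near +oo,
    C < tropical_norm f0 f1 r + tropical_norm f0 f1 (- r).
Proof.
move=> p0 o0 p1 o1 fnc; have [pn on] := piecewise_linear_max p0 o0 p1 o1.
case: (affine_or_unbounded pn on) => // -[c nE].
have affine h : piecewise_linear h -> (forall x, 0 <= omega h x) ->
    (forall x, h x <= tropical_norm f0 f1 x) -> forall x, h x = h 0 + c * x.
  move=> hpl h0 hn; case: (affine_or_unbounded hpl h0) => [[d hE] x|].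
    suff <- : d = c by exact: hE.
    apply: (@affine_le_slope _ d c (h 0) (tropical_norm f0 f1 0)) => y.
    by rewrite -hE -nE.
  (* If [h] were not affine, [h r + h (- r)] would be unbounded, yet it is at most the corresponding
     sum for the affine norm, which is constantly [2 * tropical_norm f0 f1 0]. *)
  move=> /(_ (2 * tropical_norm f0 f1 0)) hC; near (pinfty_nbhs R) => r.
  have : 2 * tropical_norm f0 f1 0 < h r + h (- r) by near: r; exact: hC.
  have := hn r; have := hn (- r); rewrite /tropical_norm (nE r) (nE (- r)).
  by rewrite mulrN; lra.
case: fnc; exists (f1 0 - f0 0) => x.
have n0 y : f0 y <= tropical_norm f0 f1 y by rewrite le_max lexx.
have n1 y : f1 y <= tropical_norm f0 f1 y by rewrite le_max lexx orbT.
by rewrite (affine f0 p0 o0 n0 x) (affine f1 p1 o1 n1 x); ring.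
Unshelve. all: by end_near. Qed.

(** * Comparison of the characteristic with the counting functions *)

Lemma zero_upper_density_set0 (R : realType) : zero_upper_density (@set0 R).
Proof.
rewrite /zero_upper_density (_ : (fun r : R => _) = cst 0%E); last first.
  by apply/funext => r; rewrite set0I Rintegral_set0 mulr0.
apply/eqP; rewrite eq_le limf_esup_ge0 ?andbT //.
apply: ereal_inf_lbound; exists setT; first exact: filterT.
by rewrite ereal_sup_cst //; apply/set0P; exists 0.
Qed.

Lemma max_shift_dist (R : realType) (a b x y : R) :
  `|Num.max (a + x) (b + y) - Num.max x y| <= `|a| + `|b|.
Proof.
have := ler_norm a; have := lerNnormlW (lexx `|a|).
have := ler_norm b; have := lerNnormlW (lexx `|b|).
have := normr_ge0 a; have := normr_ge0 b.
move: `|a| `|b| => A B ? ? ? ? ? ?.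
rewrite ler_norml.
by have [?|?] := leP (a + x) (b + y); have [?|?] := leP x y; lra.
Qed.

Theorem theorem6p5 (R : realType) (f f0 f1 : R -> R)
  (f_mero : tropical_meromorphic f)
  (f_nonconst : ~ exists c : R, forall x, f x = c)
  (f_rep : reduced_representation f f0 f1)
  (f_growth :
     limf_esup (fun r : R => (ln (characteristic f0 f1 r) / r)%:E)
       (pinfty_nbhs R) = 0%E)
  (q : nat) (a0 a1 : 'I_q -> R)
  (a_distinct : injective (fun j => a0 j - a1 j))
  (a_nontriv : forall j : 'I_q,
     ~ forall x, Num.max (f x) (a0 j - a1 j) = a0 j - a1 j) :
  exists E : set R,
    [/\ measurable E, zero_upper_density E &
        forall eps : R, 0 < eps -> \forall r \near within (~` E) (pinfty_nbhs R),
          `| q%:R * characteristic f0 f1 r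
             - \sum_(j < q)
                 pole_counting r
                   (fun x => - tropical_form (a0 j) (a1 j) f0 f1 x) |
          <= eps * `| characteristic f0 f1 r | ].
Proof.
case: f_rep => -[m0 np0] [m1 np1] _ fE.
have p0 := meromorphic_piecewise_linear m0.
have p1 := meromorphic_piecewise_linear m1.
have o0 x : 0 <= omega f0 x by rewrite leNgt; apply/negP/np0.
have o1 x : 0 <= omega f1 x by rewrite leNgt; apply/negP/np1.
exists set0; split; [exact: measurable0|exact: zero_upper_density_set0|].
move=> eps eps0; rewrite setC0 withinET.
have unbounded : forall C : R, \forall r \near +oo,
    C < tropical_norm f0 f1 r + tropical_norm f0 f1 (- r).
  apply: tropical_norm_unbounded => // -[c hc].
  by apply: f_nonconst; exists c => x; rewrite fE.
(* The values at [r], [- r] and [0] enter with weights [1/2], [1/2] and [1], whence the factor [2]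
   on the bound of [max_shift_dist]. *)
set K := \sum_(j < q) 2 * (`|a0 j| + `|a1 j|).
have counting j (r : R) : 0 <= r ->
  pole_counting r (fun x => - tropical_form (a0 j) (a1 j) f0 f1 x) =
  2^-1 * (tropical_form (a0 j) (a1 j) f0 f1 r
    + tropical_form (a0 j) (a1 j) f0 f1 (- r)) - tropical_form (a0 j) (a1 j) f0 f1 0.
  move=> r0.
  have [p0' o0'] := piecewise_linear_cstD (a0 j) p0 o0.
  have [p1' o1'] := piecewise_linear_cstD (a1 j) p1 o1.
  have [pP oP] := piecewise_linear_max p0' o0' p1' o1'.
  exact: pole_counting_opp.
have dist j (r : R) : 0 <= r -> `|characteristic f0 f1 r
    - pole_counting r (fun x => - tropical_form (a0 j) (a1 j) f0 f1 x)|
    <= 2 * (`|a0 j| + `|a1 j|).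
  move=> r0; rewrite counting //.
  have d x := max_shift_dist (a0 j) (a1 j) (f0 x) (f1 x).
  have := d r; have := d (- r); have := d 0.
  rewrite /characteristic /tropical_norm /tropical_form !ler_norml; lra.
near=> r.
have r0 : 0 <= r by near: r; apply: nbhs_pinfty_ge; exact: num_real.
(* This threshold is exactly what makes the characteristic exceed [K / eps]. *)
have Kr : 2 * (K / eps + tropical_norm f0 f1 0) <
    tropical_norm f0 f1 r + tropical_norm f0 f1 (- r).
  by near: r; exact: unbounded.
have KT : K <= eps * `|characteristic f0 f1 r|.
  rewrite mulrC -ler_pdivrMr //; apply: le_trans (ler_norm _).
  by rewrite /characteristic; lra.
apply: le_trans KT; rewrite mulr_natl -[q in _ *+ q]card_ord -sumr_const -sumrB.
by apply: le_trans (ler_norm_sum _ _ _) _; apply: ler_sum => j _; exact: dist.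
Unshelve. all: by end_near. Qed.
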